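(* Let $A$ be a weak QLS-algebra with subspace of generators $W$, let $V$ and $V'$ be two direct complements to $k\cdot e$ in $W$, and let $\Psi$ and $\Psi'$ be the corresponding CDG-algebras (constructed from $V$ and from $V'$ as described in the context). Then $\Psi'=\Psi(\alpha)$ for a uniquely defined element $\alpha\in B^1$.
   Context: Conventions: $k$ is a fixed field; an algebra is an associative $k$-algebra with unit $e$; all graded and filtered algebras are locally finite-dimensional. $[a,b]=ab-(-1)^{\tilde a\tilde b}ba$ is the supercommutator. A derivation $d$ of degree $+1$ satisfies $d(ab)=d(a)b+(-1)^{\tilde a}a\,d(b)$. Weak QLS-algebra: an algebra $A$ with a subspace of generators $W\subset A$, $e\in W$, such that, for $V$ a hyperplane in $W$ complementary to $k\cdot e$, $T_n(V)\subset T(V)$ the subspace of elements of degree $\le n$ in the tensor algebra, and $J=\ker(T(V)\to A)$: (1) $A$ is generated by $W$; (2) the ideal $J$ is generated by $J_2=J\cap T_2(V)$. (This does not depend on the choice of $V$.) Put $I=J_2\bmod T_1(V)\subset V\otimes V$; as a subspace of $(W/ke)^{\otimes2}$ it is independent of $V$. CDG-algebra: a triple $(B,d,h)$ with $B$ a graded algebra ($B^i=0$ for $i<0$), $d$ a derivation of $B$ of degree $+1$, and $h\in B^2$, such that $d^2=[h,\cdot\,]$ and $d(h)=0$. For $\Psi=(B,d,h)$ and $\alpha\in B^1$, $\Psi(\alpha)$ denotes the (equivalent) CDG-algebra $(B,\ d+[\alpha,\cdot\,],\ h+d\alpha+\alpha^2)$. CDG-algebra corresponding to $V$: $B=T(V^*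 )/(I^\perp)$, where $I^\perp\subset V^*\otimes V^*$ is the annihilator of $I$, so $B^1=V^*$ and $B^2\simeq I^*$; under the identifications $V\simeq W/ke\simeq V'$ the graded algebra $B$ is the same for $V$ and $V'$. There are unique $h\in I^*\simeq B^2$ and $\varphi\colon I\to V$ such that $J_2=\{p+\varphi(p)+h(p)\cdot 1:p\in I\}$ up to the sign convention that the relations of $A$ read $p+\varphi(p)+h(p)=0$, $p\in I$. The map $\varphi^*\colon B^1\to B^2$ extends to a derivation $d$ of $B$ of degree $+1$, and $(B,d,h)$ is a CDG-algebra.
   Formalization: Literal uniqueness of α with Ψ'=Ψ(α) fails (A=k[x], W=⟨1,x⟩, V=V'=⟨x⟩: every α∈B¹ works); ''uniquely defined'' is stated as: α∈B¹=(W/ke)* is the unique element given by v−v'=α(v)e for v∈V, v'∈V' with the same class in W/ke. *)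

(* Defs.v *)
From HB Require Import structures.
From mathcomp Require Import all_boot all_order all_algebra.
From mathcomp Require Import boolp finmap.
From mathcomp.multinomials Require Import monalg.

Set Implicit Arguments.
Unset Strict Implicit.
Unset Printing Implicit Defensive.

Import GRing.Theory.
Local Open Scope ring_scope.

Definition two_sided_ideal (R : nzRingType) (I : R -> Prop) : Prop :=
  [/\ I 0, forall x y, I x -> I y -> I (x - y),
      forall a x, I x -> I (a * x) & forall a x, I x -> I (x * a)].

Definition ideal_gen (R : nzRingType) (S : R -> Prop) (x : R) : Prop :=
  forall I : R -> Prop, two_sided_ideal I -> (forall y, S y -> I y) -> I x.

Lemma ideal_gen_ideal (R : nzRingType) (S : R -> Prop) :
  two_sided_ideal (ideal_gen S).
Proof.
split=> [I [] //|x y hx hy I hI hS|a x hx I hI hS|a x hx I hI hS];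
  have [_ hB hl hr] := hI.
- by apply: hB; [apply: hx | apply: hy].
- by apply: hl; apply: hx.
- by apply: hr; apply: hx.
Qed.

Lemma ideal_gen_in (R : nzRingType) (S : R -> Prop) x : S x -> ideal_gen S x.
Proof. by move=> hx I _; apply. Qed.

Record proper_ideal (R : nzRingType) := ProperIdeal {
  pideal :> R -> Prop;
  pidealP : two_sided_ideal pideal;
  pideal1 : ~ pideal 1 }.

(* The quotient of an algebra by a proper two-sided ideal; the library's
   ring quotients are restricted to commutative rings. *)
Section QuotientAlgebra.
Variables (k : fieldType) (T : algType k) (I : proper_ideal T).

Definition ideal_pred : {pred T} := fun x => `[< I x >].

Fact ideal_pred_zmod : zmod_closed ideal_pred.
Proof.
have [h0 hB _ _] := pidealP I.
by split=> [|x y /asboolP hx /asboolP hy]; apply/asboolP; [|apply: hB].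
Qed.
HB.instance Definition _ := GRing.isZmodClosed.Build T ideal_pred ideal_pred_zmod.

Definition quot_alg : Type := Quotient.quot ideal_pred.
HB.instance Definition _ := Choice.on quot_alg.
HB.instance Definition _ := GRing.Zmodule.on quot_alg.

Definition quot_pi (x : T) : quot_alg := \pi_(Quotient.quot ideal_pred)%qT x.

Let q := quot_pi.
Let r (b : quot_alg) : T := repr (b : Quotient.quot ideal_pred).

Let rK b : q (r b) = b. Proof. exact: reprK. Qed.

Lemma quot_pi_surj b : exists x, quot_pi x = b.
Proof. by exists (r b); apply: rK. Qed.

Lemma quot_piE x y : quot_pi x = quot_pi y <-> I (x - y).
Proof.
have := Quotient.idealrBE ideal_pred x y; rewrite /quot_pi => e.
split=> [h|/asboolP h]; last by apply/eqP; rewrite -e.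
by apply/asboolP; move/eqP: h; rewrite -e.
Qed.

Let qD x y : q (x + y) = q x + q y. Proof. exact: Quotient.pi_add. Qed.
Let qN x : q (- x) = - q x. Proof. exact: Quotient.pi_opp. Qed.
Let qB : {morph q : x y / x - y}.
Proof. by move=> x y; rewrite qD qN. Qed.

Let idMl a x : I x -> I (a * x). Proof. by have [_ _ h _] := pidealP I; apply: h. Qed.
Let idMr a x : I x -> I (x * a). Proof. by have [_ _ _ h] := pidealP I; apply: h. Qed.
Let idD x y : I x -> I y -> I (x + y).
Proof.
have [h0 hB _ _] := pidealP I; move=> hx hy.
by rewrite -[y]opprK; apply: (hB) => //; rewrite -sub0r; apply: hB.
Qed.
Let idZ c x : I x -> I (c *: x).
Proof. by rewrite -[x in c *: x]mul1r scalerAl; apply: idMl. Qed.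

Let qcomp x : I (r (q x) - x). Proof. by apply/quot_piE; exact: rK. Qed.

Definition quot_one : quot_alg := q 1.
Definition quot_mul (a b : quot_alg) : quot_alg := q (r a * r b).
Definition quot_scale (c : k) (a : quot_alg) : quot_alg := q (c *: r a).

Let qM x y : q (x * y) = quot_mul (q x) (q y).
Proof.
apply/esym/quot_piE; set x' := r _; set y' := r _.
have -> : x' * y' - x * y = (x' - x) * y' + x * (y' - y).
  by rewrite mulrBl mulrBr addrA subrK.
by apply: idD; [apply: idMr | apply: idMl]; apply: qcomp.
Qed.
Let qZ c x : q (c *: x) = quot_scale c (q x).
Proof. by apply/esym/quot_piE; rewrite -scalerBr; apply: idZ; apply: qcomp. Qed.

Let qind (P : quot_alg -> Prop) : (forall x, P (q x)) -> forall b, P b.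
Proof. by move=> h b; rewrite -(rK b). Qed.

Fact quot_mulA : associative quot_mul.
Proof. by elim/qind=> x; elim/qind=> y; elim/qind=> z; rewrite -!qM mulrA. Qed.
Fact quot_mul1 : left_id quot_one quot_mul.
Proof. by elim/qind=> x; rewrite -qM mul1r. Qed.
Fact quot_mulr1 : right_id quot_one quot_mul.
Proof. by elim/qind=> x; rewrite -qM mulr1. Qed.
Fact quot_mulDl : left_distributive quot_mul +%R.
Proof.
by elim/qind=> x; elim/qind=> y; elim/qind=> z; rewrite -qD -!qM -qD mulrDl.
Qed.
Fact quot_mulDr : right_distributive quot_mul +%R.
Proof.
by elim/qind=> x; elim/qind=> y; elim/qind=> z; rewrite -qD -!qM -qD mulrDr.
Qed.
Fact quot_one_neq0 : quot_one != 0.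
Proof.
apply/eqP; have -> : 0 = q 0 by rewrite -(subrr (0 : T)) qB subrr.
by move/quot_piE; rewrite subr0; apply: pideal1.
Qed.
HB.instance Definition _ := GRing.Zmodule_isNzRing.Build quot_alg
  quot_mulA quot_mul1 quot_mulr1 quot_mulDl quot_mulDr quot_one_neq0.

Fact quot_scaleA a b v : quot_scale a (quot_scale b v) = quot_scale (a * b) v.
Proof. by elim/qind: v => x; rewrite -!qZ scalerA. Qed.
Fact quot_scale1 : left_id 1 quot_scale.
Proof. by elim/qind=> x; rewrite -!qZ scale1r. Qed.
Fact quot_scaleDr : right_distributive quot_scale +%R.
Proof. by move=> c; elim/qind=> x; elim/qind=> y; rewrite -qD -!qZ -qD scalerDr. Qed.
Fact quot_scaleDl v : {morph quot_scale^~ v : a b / a + b}.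
Proof. by elim/qind: v => x a b; rewrite -!qZ -qD scalerDl. Qed.
HB.instance Definition _ := GRing.Zmodule_isLmodule.Build k quot_alg
  quot_scaleA quot_scale1 quot_scaleDr quot_scaleDl.

Let qME x y : q x * q y = q (x * y). Proof. by rewrite qM. Qed.
Let qZE c x : c *: q x = q (c *: x). Proof. by rewrite qZ. Qed.

Fact quot_scaleAl (c : k) (u v : quot_alg) : c *: (u * v) = (c *: u) * v.
Proof.
by elim/qind: u => x; elim/qind: v => y; rewrite qME !qZE qME scalerAl.
Qed.
HB.instance Definition _ := GRing.Lmodule_isLalgebra.Build k quot_alg quot_scaleAl.

Fact quot_scaleAr (c : k) (u v : quot_alg) : c *: (u * v) = u * (c *: v).
Proof.
by elim/qind: u => x; elim/qind: v => y; rewrite qME !qZE qME scalerAr.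
Qed.
HB.instance Definition _ := GRing.Lalgebra_isAlgebra.Build k quot_alg quot_scaleAr.

Fact quot_pi_linear : linear quot_pi.
Proof. by move=> c x y; rewrite [LHS]qD; congr (_ + _); apply: qZ. Qed.
HB.instance Definition _ := GRing.isLinear.Build k T quot_alg _ quot_pi quot_pi_linear.

Fact quot_pi_multiplicative : monoid_morphism quot_pi.
Proof. by split=> // x y; apply: qM. Qed.
HB.instance Definition _ :=
  GRing.isMonoidMorphism.Build T quot_alg quot_pi quot_pi_multiplicative.

End QuotientAlgebra.
Arguments quot_pi {k T} I x.

(* T(V) for a finite-dimensional V: noncommutative polynomials in variables
   indexed by the basis vbasis {:V}; the word i1 ... in stands for the tensor
   e_i1 (x) ... (x) e_in. *)
Definition word (k : fieldType) (V : vectType k) : Type := {fmonom 'I_(\dim {:V})}.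
HB.instance Definition _ k V := MonomialDef.on (@word k V).

Definition tensor_alg (k : fieldType) (V : vectType k) : Type := {malg k[word V]}.

Section TensorAlgebra.
Variables (k : fieldType) (V : vectType k).

HB.instance Definition _ := GRing.Lalgebra.on (tensor_alg V).

Fact tensor_scaleAr (c : k) (x y : tensor_alg V) : c *: (x * y) = x * (c *: y).
Proof.
apply/malgP => w; rewrite mcoeffZ mcoeffMl.
rewrite (mcoeffMlw _ (fsubset_refl _) (msuppZ_le c y)) mulr_sumr.
apply: eq_bigr => u _; rewrite mulr_sumr; apply: eq_bigr => v _.
by rewrite mcoeffZ mulrnAr mulrCA.
Qed.
HB.instance Definition _ :=
  GRing.Lalgebra_isAlgebra.Build k (tensor_alg V) tensor_scaleAr.

Definition tbasis (i : 'I_(\dim {:V})) : V := (vbasis {:V})`_i.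

Definition tword (w : word V) : tensor_alg V := << w >>.

Definition tin (v : V) : tensor_alg V :=
  \sum_i coord (vbasis {:V}) i v *: tword (FMonom [:: i]).

(* T^n(V) and T_n(V) *)
Definition thomog (n : nat) (x : tensor_alg V) : Prop :=
  forall w : word V, w \in msupp x -> size w = n.

Definition tfilt (n : nat) (x : tensor_alg V) : Prop :=
  forall w : word V, w \in msupp x -> (size w <= n)%N.

Definition linext (M : lmodType k) (F : word V -> M) (x : tensor_alg V) : M :=
  \sum_(w <- msupp x) x@_w *: F w.

(* The algebra morphism T(V) -> A extending f. *)
Definition tlift (A : algType k) (f : V -> A) : tensor_alg V -> A :=
  linext (fun w => \prod_(i <- (w : seq _)) f (tbasis i)).

Fact linext_is_linear (M : lmodType k) (F : word V -> M) : linear (linext F).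
Proof.
have lw (d : {fset word V}) x : (msupp x `<=` d)%fset ->
    linext F x = \sum_(w <- d) x@_w *: F w.
  move=> le; rewrite /linext (big_fset_incl _ le) //= => w _ /mcoeff_outdom ->.
  by rewrite scale0r.
move=> c x y; pose d := (msupp x `|` msupp y)%fset.
rewrite (lw d (c *: x + y)); last first.
  apply: fsubset_trans (msuppD_le _ _) _; apply: fsetSU; exact: msuppZ_le.
rewrite (lw d x) ?fsubsetUl // (lw d y) ?fsubsetUr // scaler_sumr -big_split /=.
by apply: eq_bigr => w _; rewrite mcoeffD mcoeffZ scalerDl scalerA.
Qed.
HB.instance Definition _ (M : lmodType k) (F : word V -> M) :=
  GRing.isLinear.Build k (tensor_alg V) M _ (linext F) (linext_is_linear F).

Lemma linext_word (M : lmodType k) (F : word V -> M) w : linext F (tword w) = F w.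
Proof. by rewrite /linext msuppU1 big_seq_fset1 mcoeffUU scale1r. Qed.

Lemma tensorE (x : tensor_alg V) : x = linext tword x.
Proof.
rewrite [LHS]monalgE; apply: eq_bigr => w _; apply/malgP => u.
by rewrite mcoeffZ !mcoeffU mulrnAr mulr1.
Qed.

Lemma tensor_ext (M : lmodType k) (f g : {linear tensor_alg V -> M}) :
  (forall w, f (tword w) = g (tword w)) -> f =1 g.
Proof.
move=> h x; rewrite [x]tensorE !linear_sum; apply: eq_bigr => w _.
by rewrite !linearZ h.
Qed.

Lemma twordM u v : tword u * tword v = tword (fmmul u v).
Proof. by rewrite /tword [LHS]fgmulUU mulr1. Qed.

Lemma tword1 : (1 : tensor_alg V) = tword (FMonom [::]).
Proof. by rewrite -fmoneE. Qed.

Lemma tensor_indl (P : tensor_alg V -> Prop) :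
  P 0 -> (forall w, P (tword w)) -> (forall c x y, P x -> P y -> P (c *: x + y)) ->
  forall x, P x.
Proof.
move=> h0 hw hD x; rewrite [x]tensorE /linext.
by elim/big_ind: _ => // [a b ha hb|w _]; [rewrite -[a]scale1r|rewrite -[_ *: _]addr0]; apply: hD.
Qed.

HB.instance Definition _ (A : algType k) (f : V -> A) :=
  GRing.Linear.copy (tlift f) (linext _).

Lemma tlift_monoid (A : algType k) (f : V -> A) : monoid_morphism (tlift f).
Proof.
split=> [|x y]; first by rewrite tword1 /tlift linext_word big_nil.
elim/tensor_indl: x => [|u|c x1 x2 h1 h2]; first by rewrite mul0r linear0 mul0r.
  elim/tensor_indl: y => [|v|c y1 y2 h1 h2]; first by rewrite mulr0 linear0 mulr0.
    by rewrite twordM /tlift !linext_word fmmulE big_cat.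
  by rewrite mulrDr -scalerAr !linearP /= h1 h2 mulrDr -scalerAr.
by rewrite mulrDl -scalerAl !linearP /= h1 h2 mulrDl -scalerAl.
Qed.
HB.instance Definition _ (A : algType k) (f : V -> A) :=
  GRing.isMonoidMorphism.Build (tensor_alg V) A (tlift f) (tlift_monoid f).

Lemma tin_basis i : tin (tbasis i) = tword (FMonom [:: i]).
Proof.
rewrite /tin (bigD1 i) //= coord_free ?eqxx ?(basis_free (vbasisP _)) // scale1r.
rewrite big1 ?addr0 // => j /negPf ij.
rewrite eq_sym in ij; by rewrite coord_free ?(basis_free (vbasisP _)) // ij scale0r.
Qed.

Fact tin_is_linear : linear tin.
Proof.
move=> c u v; rewrite /tin scaler_sumr -big_split /=; apply: eq_bigr => i _.
by rewrite linearP scalerDl scalerA.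
Qed.
HB.instance Definition _ :=
  GRing.isLinear.Build k V (tensor_alg V) _ tin tin_is_linear.

Lemma tbasisE v : v = \sum_i coord (vbasis {:V}) i v *: tbasis i.
Proof. exact: coord_vbasis (memvf v). Qed.

Lemma tlift_tin (A : algType k) (f : {linear V -> A}) v : tlift f (tin v) = f v.
Proof.
rewrite [RHS](congr1 f (tbasisE v)) /tin !linear_sum; apply: eq_bigr => i _.
by rewrite !linearZ /=; congr (_ *: _); rewrite /tlift linext_word big_seq1.
Qed.

Lemma twordE w : tword w = \prod_(i <- (w : seq _)) tin (tbasis i).
Proof.
case: w => s /=; elim: s => [|i s IH]; first by rewrite big_nil -tword1.
by rewrite big_cons -IH tin_basis twordM fmmulE.
Qed.

Lemma tlift_unique (A : algType k) (f : {linear V -> A})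
    (g : {lrmorphism tensor_alg V -> A}) :
  (forall v, g (tin v) = f v) -> g =1 tlift f.
Proof.
move=> h; apply: tensor_ext => w /=; rewrite /tlift linext_word twordE rmorph_prod.
by apply: eq_bigr => i _; apply: h.
Qed.

End TensorAlgebra.

(* The component of degree n; locked because unfolding it is costly. *)
HB.lock Definition tcomp (k : fieldType) (V : vectType k) (n : nat)
    (x : tensor_alg V) : tensor_alg V :=
  linext (fun w => if size w == n then tword w else 0) x.

Section HomogeneousTensors.
Variables (k : fieldType) (V : vectType k).
Implicit Types (x y : tensor_alg V) (w : word V).

Fact tcomp_is_linear n : linear (@tcomp k V n).
Proof. by move=> c x y; rewrite tcomp.unlock linearP. Qed.
HB.instance Definition _ n :=
  GRing.isLinear.Build k (tensor_alg V) (tensor_alg V) _ (@tcomp k V n)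
    (tcomp_is_linear n).

Lemma mcoeff_tcomp n x w : (tcomp n x)@_w = if size w == n then x@_w else 0.
Proof.
elim/tensor_indl: x => [|u|c x y hx hy].
- by rewrite linear0 mcoeff0 if_same.
- rewrite tcomp.unlock linext_word (fun_if (mcoeff w)) mcoeff0 mcoeffU1.
  by have [->//|nuw] := eqVneq u w; rewrite !if_same.
- rewrite linearP /= mcoeffD mcoeffZ [in RHS]mcoeffD [in RHS]mcoeffZ hx hy.
  by case: ifP; rewrite ?mulr0 ?addr0.
Qed.

Lemma thomogP n x : thomog n x <-> tcomp n x = x.
Proof.
split=> [h|h w].
  apply/malgP => w; rewrite mcoeff_tcomp; case: ifP => // hw.
  apply/esym/mcoeff_outdom/negP => /h e; by rewrite e eqxx in hw.
by rewrite -h -mcoeff_neq0 mcoeff_tcomp; case: ifP => [/eqP//|_]; rewrite eqxx.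
Qed.

Lemma thomog_tcomp n x : thomog n (tcomp n x).
Proof.
apply/thomogP; apply/malgP => w; rewrite [LHS]mcoeff_tcomp.
by rewrite [X in if _ then X else _]mcoeff_tcomp [RHS]mcoeff_tcomp; case: (size w == n).
Qed.

Lemma tcomp_thomog m n x : thomog n x -> tcomp m x = if m == n then x else 0.
Proof.
move=> h; have [->|nmn] := eqVneq m n; first exact/thomogP.
apply/malgP => w; rewrite mcoeff_tcomp mcoeff0; case: ifP => // /eqP hw.
by apply: mcoeff_outdom; apply: contra nmn => /h <-; rewrite hw.
Qed.

Lemma thomogD n c x y : thomog n x -> thomog n y -> thomog n (c *: x + y).
Proof. by move=> /thomogP hx /thomogP hy; apply/thomogP; rewrite linearP /= hx hy. Qed.

Lemma thomog0 n : thomog n (0 : tensor_alg V).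
Proof. by apply/thomogP; rewrite linear0. Qed.

Lemma thomog_word w : thomog (size w) (tword w).
Proof. by move=> u; rewrite msuppU1 inE => /eqP ->. Qed.

Lemma thomog1 : thomog 0 (1 : tensor_alg V).
Proof. rewrite tword1; exact: thomog_word. Qed.

Lemma thomog_tin (v : V) : thomog 1 (tin v).
Proof.
rewrite /tin; elim/big_ind: _ => [|x y hx hy|i _]; first exact: thomog0.
  by rewrite -[x]scale1r; apply: thomogD.
rewrite -[_ *: _]addr0; apply: thomogD; last exact: thomog0.
exact: thomog_word.
Qed.

Lemma tcompM n x y :
  tcomp n (x * y) = \sum_(i < n.+1) tcomp i x * tcomp (n - i) y.
Proof.
elim/tensor_indl: x => [|u|c x1 x2 h1 h2].
- by rewrite mul0r !linear0 big1 // => i _; rewrite linear0 mul0r.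
- elim/tensor_indl: y => [|v|c y1 y2 h1 h2].
  + by rewrite mulr0 !linear0 big1 // => i _; rewrite linear0 mulr0.
  + rewrite twordM (tcomp_thomog n (@thomog_word (fmmul u v))).
    under eq_bigr => i _ do rewrite (tcomp_thomog _ (@thomog_word u))
      (tcomp_thomog _ (@thomog_word v)).
    rewrite fmmulE /= size_cat.
    have [->|nn] := eqVneq n (size u + size v)%N.
      have hi : (size u < (size u + size v).+1)%N by rewrite ltnS leq_addr.
      rewrite (bigD1 (Ordinal hi)) //= eqxx addKn eqxx twordM fmmulE big1 ?addr0 //.
      by move=> i; rewrite -val_eqE /= => /negPf ->; rewrite mul0r.
    rewrite big1 // => i _; case: eqP => [ei|_]; last by rewrite mul0r.
    case: eqP => [ej|_]; last by rewrite mulr0.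
    by case/eqP: nn; rewrite -ei -ej subnKC // -ltnS.
  + rewrite mulrDr -scalerAr linearP /=.
    apply: (etrans (congr2 (fun a b => c *: a + b) h1 h2)).
    rewrite scaler_sumr -big_split /=.
    by apply: eq_bigr => i _; rewrite linearP /= mulrDr -scalerAr.
- rewrite mulrDl -scalerAl linearP /=.
    apply: (etrans (congr2 (fun a b => c *: a + b) h1 h2)).
    rewrite scaler_sumr -big_split /=.
  by apply: eq_bigr => i _; rewrite linearP /= mulrDl -scalerAl.
Qed.

Lemma thomogM m n x y : thomog m x -> thomog n y -> thomog (m + n) (x * y).
Proof.
move=> hx hy; apply/thomogP; rewrite tcompM.
have hm : (m < (m + n).+1)%N by rewrite ltnS leq_addr.
rewrite (bigD1 (Ordinal hm)) //= addKn (thomogP m x).1 // (thomogP n y).1 //.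
rewrite big1 ?addr0 // => i; rewrite -val_eqE /= => /negPf im.
by rewrite (tcomp_thomog _ hx) im mul0r.
Qed.

Lemma tcomp_sum x : exists N, x = \sum_(i < N) tcomp i x.
Proof.
exists (\max_(w <- msupp x) size w).+1; apply/malgP => w.
rewrite raddf_sum /=; under eq_bigr => i _ do rewrite mcoeff_tcomp.
have [hw|hw] := boolP (w \in msupp x); last first.
  by rewrite (mcoeff_outdom hw) big1 // => i _; rewrite if_same.
have hN : (size w < (\max_(w <- msupp x) size w).+1)%N.
  by rewrite ltnS; apply: leq_bigmax_seq.
rewrite (bigD1 (Ordinal hN)) //= eqxx big1 ?addr0 // => i.
by rewrite -val_eqE /= eq_sym => /negPf ->.
Qed.

End HomogeneousTensors.

Record is_graded (k : fieldType) (B : algType k) (gr : nat -> B -> Prop) : Prop :=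
  IsGraded {
    gr0 : forall n, gr n 0;
    grP : forall n c x y, gr n x -> gr n y -> gr n (c *: x + y);
    gr1 : gr 0%N 1;
    grM : forall m n x y, gr m x -> gr n y -> gr (m + n)%N (x * y);
    gr_sum : forall x, exists N (y : nat -> B),
      (forall n, gr n (y n)) /\ x = \sum_(i < N) y i;
    gr_indep : forall N (y : nat -> B), (forall n, gr n (y n)) ->
      \sum_(i < N) y i = 0 -> forall i, (i < N)%N -> y i = 0;
    gr_fin : forall n, exists s : seq B, forall x, gr n x ->
      exists c : nat -> k, x = \sum_(i < size s) c i *: s`_i }.

Record graded_alg (k : fieldType) := GradedAlg {
  galg :> algType k;
  gcomp : nat -> galg -> Prop;
  gcompP : is_graded gcomp }.

(* The quadratic algebra T(X)/(R), for a set R of relations; only the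
   elements of R lying in X (x) X are used. *)
Section QuadraticAlgebra.
Variables (k : fieldType) (X : vectType k) (R : tensor_alg X -> Prop).

Definition quad_rel (x : tensor_alg X) : Prop := thomog 2 x /\ R x.

Fact quad_ideal1 : ~ ideal_gen quad_rel 1.
Proof.
pose z (_ : X) : k^o := 0.
move=> /(_ (fun x => tlift z x = 0)) h; suff /eqP: tlift z 1 = 0.
  by rewrite rmorph1 oner_eq0.
apply: h => [|x [hx _]].
  split=> [|x y hx hy|a x hx|a x hx].
  - by rewrite linear0.
  - by rewrite linearB /= hx hy subr0.
  - by rewrite rmorphM /= hx mulr0.
  - by rewrite rmorphM /= hx mul0r.
rewrite /tlift /linext big1_seq // => w /andP [_ /hx].
by case: w => [[|i s]] //= _; rewrite big_cons mul0r scaler0.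
Qed.

Definition quad_ideal : proper_ideal (tensor_alg X) :=
  ProperIdeal (ideal_gen_ideal quad_rel) quad_ideal1.

Definition quad_pi : tensor_alg X -> quot_alg quad_ideal := quot_pi quad_ideal.
HB.instance Definition _ := GRing.LRMorphism.copy quad_pi (quot_pi quad_ideal).

Definition quad_gr (n : nat) (b : quot_alg quad_ideal) : Prop :=
  exists2 x, thomog n x & b = quad_pi x.

Lemma quad_pi_eq0 x : quad_pi x = 0 <-> ideal_gen quad_rel x.
Proof.
by rewrite -(linear0 quad_pi); split=> [/quot_piE|h]; rewrite ?subr0 //;
  apply/quot_piE; rewrite subr0.
Qed.

Lemma quad_ideal_homog n x : ideal_gen quad_rel x -> ideal_gen quad_rel (tcomp n x).
Proof.
have [I0 IB Il Ir] := ideal_gen_ideal quad_rel.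
have Isum N (F : 'I_N -> tensor_alg X) :
    (forall i, ideal_gen quad_rel (F i)) -> ideal_gen quad_rel (\sum_i F i).
  move=> hF; elim/big_ind: _ => // a b ha hb.
  by rewrite -[b]opprK; apply: (IB) => //; rewrite -sub0r; apply: (IB).
move=> /(_ (fun x => forall n, ideal_gen quad_rel (tcomp n x))); apply.
  split=> [m|a b ha hb m|a b hb m|a b hb m].
  - by rewrite linear0.
  - by rewrite linearB; apply: IB; [apply: ha | apply: hb].
  - by rewrite tcompM; apply: Isum => i; apply: Il; apply: hb.
  - by rewrite tcompM; apply: Isum => i; apply: Ir; apply: hb.
move=> y hy m; rewrite (tcomp_thomog m hy.1); case: ifP => _ //.
exact: ideal_gen_in.
Qed.

Fact quad_is_graded : is_graded quad_gr.
Proof.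
split.
- by move=> n; exists 0; [apply: thomog0|rewrite linear0].
- move=> n c _ _ [x hx ->] [y hy ->]; exists (c *: x + y); first exact: thomogD.
  by rewrite linearP.
- by exists 1; [apply: thomog1|rewrite rmorph1].
- move=> m n _ _ [x hx ->] [y hy ->]; exists (x * y); first exact: thomogM.
  by rewrite rmorphM.
- move=> b; have [x <-] := quot_pi_surj b; have [N hN] := tcomp_sum x.
  exists N, (fun i => quad_pi (tcomp i x)); split=> [n|].
    by exists (tcomp n x); first exact: thomog_tcomp.
  by rewrite -linear_sum -hN.
- move=> N y hy; pose z n := projT1 (cid2 (hy n)).
  have hz n : thomog n (z n) /\ y n = quad_pi (z n).
    by rewrite /z; case: (cid2 _).
  rewrite (eq_bigr (fun i : 'I_N => quad_pi (z i))) => [|i _]; last by case: (hz i).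
  rewrite -linear_sum => /quad_pi_eq0 h i iN; rewrite (hz i).2; apply/quad_pi_eq0.
  have := quad_ideal_homog i h; rewrite linear_sum (bigD1 (Ordinal iN)) //=.
  rewrite (tcomp_thomog _ (hz i).1) eqxx big1 ?addr0 // => j.
  rewrite -val_eqE /= (tcomp_thomog _ (hz j).1) eq_sym => /negPf -> //.
- move=> n.
  pose s := [seq (FMonom (val t) : word X) | t <- enum {: n.-tuple 'I_(\dim {:X})}].
  exists [seq quad_pi (tword w) | w <- s] => _ [x hx ->].
  exists (fun i => x@_(nth (FMonom [::] : word X) s i)); rewrite size_map.
  have us : uniq s.
    by rewrite map_inj_uniq ?enum_uniq // => a b [] /val_inj.
  have ms w : w \in msupp x -> w \in s.
    move=> /hx /eqP sw; apply/mapP; exists (Tuple sw); first by rewrite mem_enum.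
    by case: w sw.
  rewrite [in LHS](tensorE x) /linext.
  transitivity (quad_pi (\sum_(w <- s) x@_w *: tword w)).
    congr quad_pi; rewrite [RHS](bigID (mem (msupp x))) /= [X in _ + X]big1 ?addr0.
      rewrite -[RHS]big_filter; apply: perm_big; apply: uniq_perm.
      - exact: fset_uniq.
      - exact: filter_uniq.
      - by move=> w; rewrite mem_filter; case: (boolP (w \in msupp x)) => // /ms ->.
    by move=> w /mcoeff_outdom ->; rewrite scale0r.
  rewrite (big_nth (FMonom [::] : word X)) big_mkord linear_sum.
  apply: eq_bigr => i _; rewrite linearZ /= (nth_map (FMonom [::] : word X)) //.
Qed.

Definition quad_alg : graded_alg k := GradedAlg quad_is_graded.
End QuadraticAlgebra.

(* Supercommutator of a in degree m and b in degree n. *)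
Definition scomm (R : nzRingType) (m n : nat) (a b : R) : R :=
  a * b - (-1) ^+ (m * n) * (b * a).

Record cdg_algebra (k : fieldType) (B : graded_alg k) := CDGAlgebra {
  cdg_d : {linear B -> B};
  cdg_h : B;
  cdg_deg : forall n b, gcomp n b -> gcomp n.+1 (cdg_d b);
  cdg_leibniz : forall m (a b : B), gcomp m a ->
    cdg_d (a * b) = cdg_d a * b + (-1) ^+ m * (a * cdg_d b);
  cdg_h_deg : gcomp 2 cdg_h;
  cdg_square : forall n (b : B), gcomp n b ->
    cdg_d (cdg_d b) = scomm 2 n cdg_h b;
  cdg_bianchi : cdg_d cdg_h = 0 }.

(* Psi' = Psi(alpha), for alpha of degree 1; an equality of linear maps on B
   amounts to their equality on homogeneous elements. *)
Definition cdg_twist (k : fieldType) (B : graded_alg k)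
    (Psi : cdg_algebra B) (alpha : B) (Psi' : cdg_algebra B) : Prop :=
  (forall n (b : B), gcomp n b ->
     cdg_d Psi' b = cdg_d Psi b + scomm 1 n alpha b) /\
  cdg_h Psi' = cdg_h Psi + cdg_d Psi alpha + alpha ^+ 2.

(* X/Y, modelled on a complement of Y in X. *)
Section QuotientSpace.
Variables (k : fieldType) (X : vectType k) (Y : {vspace X}).

Definition quotv : vectType k := subvs_of (Y^C)%VS.

Definition quotv_pi : 'Hom(X, quotv) :=
  (linfun (vsproj (Y^C)%VS) \o daddv_pi (Y^C)%VS Y)%VF.

Lemma quotv_piE x : vsval (quotv_pi x) = daddv_pi (Y^C)%VS Y x.
Proof. by rewrite /quotv_pi comp_lfunE lfunE /= vsprojK // memv_pi. Qed.

Lemma quotv_pi_ker : lker quotv_pi = Y.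
Proof.
have dYC : (Y^C :&: Y = 0)%VS by rewrite capvC capv_compl.
have hs : (Y^C + Y = fullv)%VS by rewrite addvC addv_complf.
apply/vspaceP => x; rewrite memv_ker.
have := daddv_pi_add dYC (w := x); rewrite hs memvf => /(_ isT) hx.
apply/eqP/idP => [h|xY].
  by rewrite -hx -quotv_piE h linear0 add0r memv_pi.
apply: val_inj; rewrite -[LHS]/(vsval _) quotv_piE linear0.
have hd : (Y :&: Y^C = 0)%VS by rewrite capv_compl.
by move: hx; rewrite (daddv_pi_id hd xY) -[RHS]add0r => /addIr.
Qed.

Lemma quotv_pi_surj u : exists x, quotv_pi x = u.
Proof.
have dYC : (Y^C :&: Y = 0)%VS by rewrite capvC capv_compl.
exists (vsval u); apply: val_inj; rewrite -[LHS]/(vsval _) quotv_piE.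
exact: daddv_pi_id (subvsP u).
Qed.

End QuotientSpace.

Definition dual (k : fieldType) (X : vectType k) : vectType k := 'Hom(X, k^o).

(* The pairing of T(X^* ) with T(X) given by
     <f1 ... fn, v1 ... vn> = f1(v1) ... fn(vn);
   tensors of different degrees are orthogonal. *)
Section Pairing.
Variables (k : fieldType) (X : vectType k).

Definition wpair (m : word (dual X)) (w : word X) : k :=
  if size m == size w then
    \prod_(ij <- zip m w) (tbasis ij.1 : dual X) (tbasis ij.2)
  else 0.

Definition tpair (xi : tensor_alg (dual X)) (p : tensor_alg X) : k :=
  \sum_(m <- msupp xi) \sum_(w <- msupp p) xi@_m * p@_w * wpair m w.

Definition annihilator (S : tensor_alg X -> Prop) (xi : tensor_alg (dual X)) : Prop :=
  forall p, S p -> tpair xi p = 0.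

Fact tpairE (xi : tensor_alg (dual X)) (p : tensor_alg X) :
  tpair xi p = linext (fun m => linext (fun w => wpair m w : k^o) p : k^o) xi.
Proof.
rewrite /tpair /linext; apply: eq_bigr => m _; rewrite scaler_sumr.
by apply: eq_bigr => w _; rewrite scalerA.
Qed.

Fact tin2E (Z : vectType k) (u v : Z) : tin u * tin v =
  \sum_i \sum_j (coord (vbasis {:Z}) i u * coord (vbasis {:Z}) j v) *:
    tword (FMonom [:: i; j] : word Z).
Proof.
rewrite /tin mulr_suml; apply: eq_bigr => i _; rewrite mulr_sumr.
apply: eq_bigr => j _.
by rewrite -scalerAr -scalerAl scalerA twordM fmmulE mulrC.
Qed.

Lemma tpair2 (f g : dual X) (v w : X) :
  tpair (tin f * tin g) (tin v * tin w) = f v * g w.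
Proof.
have fE (b : dual X) x : b x = \sum_i \sum_j
    coord (vbasis {:dual X}) i b * coord (vbasis {:X}) j x *
      (tbasis i : dual X) (tbasis j).
  rewrite [in LHS](tbasisE b) sum_lfunE; apply: eq_bigr => i _.
  rewrite [in LHS](tbasisE x) scale_lfunE linear_sum scaler_sumr.
  by apply: eq_bigr => j _; rewrite linearZ -mulrA.
rewrite tpairE !tin2E (fE f v) (fE g w) mulr_suml linear_sum /=.
apply: eq_bigr => i _; rewrite mulr_sumr linear_sum /=; apply: eq_bigr => j _.
rewrite linearZ /= linext_word [X in _ *: X]linear_sum /= scaler_sumr big_distrlr /=.
apply: eq_bigr => a _; rewrite [X in _ *: X]linear_sum scaler_sumr /=.
apply: eq_bigr => b _; rewrite linearZ /= linext_word /wpair /= !big_cons big_nil mulr1.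
by rewrite /GRing.scale /= [LHS]mulrA [X in X * _ = _]mulrACA [LHS]mulrACA.
Qed.

End Pairing.

Definition tmap (k : fieldType) (X Y : vectType k) (f : X -> Y) :
  tensor_alg X -> tensor_alg Y := tlift (fun x => tin (f x)).

(* A finite-dimensional subspace W of A containing the unit; gunit is the
   unit, seen as an element of W. *)
Record unital_subspace (k : fieldType) (A : algType k) := UnitalSubspace {
  gspace :> vectType k;
  gincl : {linear gspace -> A};
  gincl_inj : injective gincl;
  gunit : gspace;
  gunitE : gincl gunit = 1 }.

Section WeakQLS.
Variables (k : fieldType) (A : algType k) (W : unital_subspace A).
Implicit Types (V : {vspace W}).

Local Notation e := (gunit W).

Definition complement V : Prop := (V + <[e]> = fullv)%VS /\ (V :&: <[e]> = 0)%VS.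

Definition tensor_eval V : tensor_alg (subvs_of V) -> A :=
  tlift (fun v => gincl W (vsval v)).

Definition relJ V (x : tensor_alg (subvs_of V)) : Prop := tensor_eval x = 0.

Definition relJ2 V (x : tensor_alg (subvs_of V)) : Prop := relJ x /\ tfilt 2 x.

Definition weak_qls : Prop :=
  (forall S : {pred A}, GRing.subalg_closed S -> (forall w : W, gincl W w \in S) ->
     forall a, a \in S) /\
  (forall V, complement V -> forall x, relJ x <-> ideal_gen (@relJ2 V) x).

(* I = J_2 mod T_1(V), as a subset of T^2(V). *)
Definition relI V (p : tensor_alg (subvs_of V)) : Prop :=
  thomog 2 p /\ exists2 r, tfilt 1 r & relJ2 (p + r).

Definition Wbar : vectType k := quotv <[e]>%VS.
Definition Wpi : 'Hom(W, Wbar) := quotv_pi <[e]>%VS.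

Definition tproj V : tensor_alg (subvs_of V) -> tensor_alg Wbar :=
  tmap (fun v => Wpi (vsval v)).

(* I as a subspace of the tensor square of W/ke. *)
Definition quadI (p : tensor_alg Wbar) : Prop :=
  exists V, complement V /\ exists2 p0, @relI V p0 & p = tproj p0.

(* quadI does not depend on the complement used to compute it. *)
Section Independence.

Let linext_ind (X : vectType k) (M : lmodType k) (F : word X -> M) (P : M -> Prop) x :
  P 0 -> (forall c a b, P a -> P b -> P (c *: a + b)) ->
  (forall w, w \in msupp x -> P (F w)) -> P (linext F x).
Proof.
move=> P0 PD PF; rewrite /linext big_seq; elim/big_ind: _ => //.
  by move=> a b ha hb; rewrite -[a]scale1r; apply: PD.
by move=> w hw; rewrite -[_ *: _]addr0; apply: PD => //; apply: PF.
Qed.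

Let tfiltD (X : vectType k) n c (x y : tensor_alg X) :
  tfilt n x -> tfilt n y -> tfilt n (c *: x + y).
Proof.
move=> hx hy w /(fsubsetP (msuppD_le _ _)); rewrite in_fsetU.
by case/orP=> [/(fsubsetP (msuppZ_le _ _))/hx|/hy].
Qed.

Let tfilt0 (X : vectType k) n : tfilt n (0 : tensor_alg X).
Proof. by move=> w; rewrite msupp0 in_fset0. Qed.

Let tfilt_homog (X : vectType k) m n (x : tensor_alg X) :
  (m <= n)%N -> thomog m x -> tfilt n x.
Proof. by move=> mn hx w /hx ->. Qed.

Let quadI_sub V V' p0 : complement V -> complement V' -> @relI V p0 ->
  exists2 p0', @relI V' p0' & tproj p0 = tproj p0'.
Proof.
move=> [_ _] [hD' hI'] [hp0 [r hr [hJ _]]].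
pose tau (v : subvs_of V) : subvs_of V' :=
  vsproj V' (daddv_pi V' <[e]>%VS (vsval v)).
have ha (v : subvs_of V) : exists c, vsval v = vsval (tau v) + c *: e.
  have := daddv_pi_add hI' (w := vsval v); rewrite hD' memvf => /(_ isT) hv.
  have /vlineP [c hc] := memv_pi <[e]>%VS V' (vsval v).
  by exists c; rewrite -hc /tau vsprojK ?memv_pi.
pose a v := projT1 (cid (ha v)).
have haE v : vsval v = vsval (tau v) + a v *: e by rewrite /a; case: (cid _).
pose theta := tlift (fun v => tin (tau v) + (a v)%:A).
have evt U (v : subvs_of U) : tensor_eval (tin v) = gincl W (vsval v).
  exact: (tlift_tin (gincl W \o vsval)).
have evD U (v : subvs_of U) c :
    tensor_eval (tin v + c%:A) = gincl W (vsval v + c *: e).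
  rewrite [LHS]linearD linearZ /= rmorph1 -[X in X + _]/(tensor_eval _) evt.
  by rewrite linearD linearZ /= gunitE.
have hev x : tensor_eval (theta x) = tensor_eval x.
  elim/tensor_indl: x => [|w|c x y hx hy].
  - by rewrite /theta /tensor_eval !linear0.
  - rewrite /theta [X in tensor_eval X]linext_word /tensor_eval rmorph_prod /=.
    rewrite [RHS]linext_word; apply: eq_bigr => i _.
    by rewrite [LHS]evD -haE.
  - rewrite /theta /tensor_eval !linearP /=.
    exact: (congr2 (fun u v => c *: u + v) hx hy).
pose p1 := tmap tau p0.
have hp1 : thomog 2 p1.
  apply: (@linext_ind _ _ _ (thomog 2)); [exact: thomog0|exact: thomogD|move=> w /hp0].
  case: w => [[|i [|j [|? ?]]]] //= _; rewrite big_cons big_seq1.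
  exact: (@thomogM _ _ 1 1 _ _ (@thomog_tin _ _ _) (@thomog_tin _ _ _)).
have hpi : tproj p0 = tproj p1.
  rewrite /p1; elim/tensor_indl: (p0) => [|w|c x y hx hy].
  - by rewrite /tproj /tmap !linear0.
  - rewrite [LHS]linext_word [X in tproj X]linext_word /tproj /tmap rmorph_prod.
    apply: eq_bigr => i _ /=.
    rewrite [RHS](tlift_tin (@tin _ Wbar \o (Wpi \o vsval))) /=; congr tin.
    rewrite [in LHS]haE linearD linearZ /=.
    have -> : Wpi e = 0 by apply/eqP; rewrite -memv_ker quotv_pi_ker memv_line.
    by rewrite scaler0 addr0.
  - rewrite /tproj /tmap !linearP /=.
    exact: (congr2 (fun u v => c *: u + v) hx hy).
have tfE u : tfilt 1 (tin (tau u) + (a u)%:A).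
  rewrite addrC; apply: tfiltD; first exact: (tfilt_homog _ (@thomog1 _ _)).
  exact: (tfilt_homog _ (@thomog_tin _ _ _)).
exists p1 => //; split=> //.
have hr1 : tfilt 1 (theta (p0 + r) - p1).
  have -> : theta (p0 + r) - p1 = 1 *: (theta p0 - p1) + theta r.
    by rewrite /theta linearD /= scale1r addrAC.
  apply: tfiltD; last first.
    apply: (@linext_ind _ _ _ (tfilt 1)); [exact: tfilt0|exact: tfiltD|move=> w /hr].
    case: w => [[|i [|? ?]]] //= _; last by rewrite big_seq1.
    by rewrite big_nil; exact: (tfilt_homog _ (@thomog1 _ _)).
  rewrite /theta /p1 /tmap /tlift /linext -sumrB.
  rewrite (eq_bigr _ (fun w _ => esym (scalerBr _ _ _))).
  apply: (@linext_ind _ _ (fun w => _ - _) (tfilt 1)); [exact: tfilt0|exact: tfiltD|move=> w /hp0].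
  case: w => [[|i [|j [|? ?]]]] //= _; rewrite [X in X - _]big_cons [X in _ * X - _]big_seq1.
  rewrite [X in _ - X]big_cons [X in _ - _ * X]big_seq1.
  have mE (R : algType k) (x y : R) (c d : k) :
      (x + c%:A) * (y + d%:A) - x * y = d *: x + (c *: (y + d%:A) + 0).
    by rewrite addr0 mulrDl mulr_algl mulrDr mulr_algr addrC -!addrA addKr.
  rewrite mE; apply: tfiltD; first exact: (tfilt_homog _ (@thomog_tin _ _ _)).
  by apply: tfiltD; [exact: tfE|exact: tfilt0].
have pE : p1 + (theta (p0 + r) - p1) = theta (p0 + r) by rewrite addrC subrK.
exists (theta (p0 + r) - p1); first exact: hr1.
rewrite pE; split.
  by rewrite /relJ hev.
rewrite -[theta _](subrK p1) -[_ - p1]scale1r; apply: tfiltD.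
  by move=> w /hr1 h; apply: leq_trans h _.
exact: (@tfilt_homog _ 2 2 _ _ hp1).
Qed.

Lemma quadI_complement V : complement V ->
  forall p, quadI p <-> exists2 p0, @relI V p0 & p = tproj p0.
Proof.
move=> hV p; split=> [[V' [hV' [p0 hp0 ->]]]|h]; last by exists V.
by have [q hq e] := quadI_sub hV' hV hp0; exists q.
Qed.

End Independence.

Definition dual_alg : graded_alg k := quad_alg (annihilator quadI).

Definition dual_pi : tensor_alg (dual Wbar) -> dual_alg :=
  quad_pi (annihilator quadI).

Definition dual_gen (beta : dual Wbar) : dual_alg := dual_pi (tin beta).

(* b in B^2 corresponds to the functional f on I under B^2 = I^*; only the
   values of f on I matter. *)
Definition repr2 V (b : dual_alg) (f : tensor_alg (subvs_of V) -> k) : Prop :=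
  exists2 xi, thomog 2 xi /\ b = dual_pi xi &
    forall p, relI p -> tpair xi (tproj p) = f p.

(* J_2 = {p + phi(p) + h(p) : p in I}, d extends phi^* : B^1 -> B^2, and the
   curvature is h. The values of phi and h outside I are irrelevant. *)
Definition cdg_of V (Psi : cdg_algebra dual_alg) : Prop :=
  exists (phi : tensor_alg (subvs_of V) -> subvs_of V)
         (h : tensor_alg (subvs_of V) -> k),
  [/\ forall x, relJ2 x <-> exists2 p, relI p & x = p + tin (phi p) + (h p)%:A,
      forall beta : dual Wbar,
        repr2 (cdg_d Psi (dual_gen beta)) (fun p => beta (Wpi (vsval (phi p))))
    & repr2 (cdg_h Psi) h].

(* The element of B^1 = (W/ke)^* measuring the difference of two
   complements: v = v' + alpha(v) e whenever v in V and v' in V' have the same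
   class in W/ke. *)
Definition complement_diff V V' (alpha : dual_alg) : Prop :=
  exists2 a : dual Wbar, alpha = dual_gen a &
    forall v v', v \in V -> v' \in V' -> Wpi v = Wpi v' ->
      v - v' = a (Wpi v) *: e.

End WeakQLS.

(* Main.v *)
(* If [v = v' + a(v) e] relates the representatives in [V] and [V'] of a class in
   [W/ke], then [a] is a linear form on [W/ke], and substituting in a relation
   [p + phi(p) + h(p) = 0] of [A] gives
     phi'(p) = phi(p) + (a (x) 1 + 1 (x) a)(p),
     h'(p) = h(p) + a(phi(p)) + (a (x) a)(p).
   Dually, with [alpha = a] in [B^1 = (W/ke)^*], these are [d' = d + [alpha, .]] on
   [B^1] and [h' = h + d alpha + alpha^2]; derivations agreeing on [B^1] agree. *)
Require Import Defs.
From HB Require Import structures.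
From mathcomp Require Import all_boot all_order all_algebra.
From mathcomp Require Import finmap.
From mathcomp.multinomials Require Import monalg.

Set Implicit Arguments.
Unset Strict Implicit.
Unset Printing Implicit Defensive.

Import GRing.Theory.
Local Open Scope ring_scope.

(** * Tensors of degree at most 2 and the pairing in degree 2 *)

Section Tensors.
Variables (k : fieldType) (X : vectType k).

Lemma linext_closed (M : lmodType k) (F : word X -> M) (P : M -> Prop) x :
  P 0 -> (forall c a b, P a -> P b -> P (c *: a + b)) ->
  (forall w, w \in msupp x -> P (F w)) -> P (linext F x).
Proof.
move=> P0 PD PF; rewrite /linext big_seq; elim/big_ind: _ => //.
  by move=> a b ha hb; rewrite -[a]scale1r; apply: PD.
by move=> w hw; rewrite -[_ *: _]addr0; apply: PD => //; apply: PF.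
Qed.

(** A word of length 2 is a product of two basis vectors. Asking for [P] on products of arbitrary
    vectors keeps bases out of the later inductions. *)
Lemma thomog2_ind (P : tensor_alg X -> Prop) :
  P 0 -> (forall c x y, P x -> P y -> P (c *: x + y)) ->
  (forall u v, P (tin u * tin v)) -> forall x, thomog 2 x -> P x.
Proof.
move=> P0 PD PM x hx; rewrite (tensorE x).
apply: linext_closed => // -[[|i [|j [|? ?]]]] /hx //= _.
by rewrite twordE big_cons big_seq1.
Qed.

Lemma thomogDl n (x y : tensor_alg X) : thomog n x -> thomog n y -> thomog n (x + y).
Proof. by move=> hx hy; rewrite -[x]scale1r; apply: thomogD. Qed.

Lemma tfilt_thomog m n (x : tensor_alg X) : (m <= n)%N -> thomog m x -> tfilt n x.
Proof. by move=> mn hx w /hx ->. Qed.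

Lemma tfiltDl n (x y : tensor_alg X) : tfilt n x -> tfilt n y -> tfilt n (x + y).
Proof.
by move=> hx hy w /(fsubsetP (msuppD_le _ _)); rewrite in_fsetU => /orP[/hx|/hy].
Qed.

Lemma thomogZ1 (c : k) : thomog 0 (c%:A : tensor_alg X).
Proof. by rewrite -[_ *: _]addr0; apply: thomogD; [apply: thomog1|apply: thomog0]. Qed.

(** [tpart1] and [tpart0] are left inverses of [tin] and of the inclusion of scalars that vanish in
    all other degrees; they separate the terms of a relation [p + tin v + c%:A]. *)
Definition tpart1 : tensor_alg X -> X :=
  linext (fun w => if (w : seq _) is [:: i] then tbasis i else 0).
HB.instance Definition _ := GRing.Linear.copy tpart1 (linext _).

Definition tpart0 : tensor_alg X -> k^o :=
  linext (fun w => if (w : seq _) is [::] then 1 else 0 : k^o).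
HB.instance Definition _ := GRing.Linear.copy tpart0 (linext _).

Lemma tpart1_tin v : tpart1 (tin v) = v.
Proof.
rewrite [RHS]tbasisE /tin linear_sum; apply: eq_bigr => i _.
by rewrite linearZ /= /tpart1 linext_word.
Qed.

Lemma tpart1_homog n x : n != 1 -> thomog n x -> tpart1 x = 0.
Proof.
move=> hn hx; apply: (@linext_closed _ _ (eq^~ 0)) => // [c a b -> ->|].
  by rewrite scaler0 addr0.
by move=> [[|i [|? ?]]] /hx //= e; rewrite -e in hn.
Qed.

Lemma tpart0_scalar c : tpart0 c%:A = c.
Proof. by rewrite linearZ tword1 /= /tpart0 linext_word; apply: mulr1. Qed.

Lemma tpart0_homog n x : n != 0 -> thomog n x -> tpart0 x = 0.
Proof.
move=> hn hx; apply: (@linext_closed _ _ (eq^~ 0)) => // [c a b -> ->|].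
  by rewrite scaler0 addr0.
by move=> [[|i ?]] /hx //= e; rewrite -e in hn.
Qed.

Lemma tpart1D x y : tpart1 (x + y) = tpart1 x + tpart1 y.
Proof. exact: linearD. Qed.

Lemma tpart0D x y : tpart0 (x + y) = tpart0 x + tpart0 y.
Proof. exact: linearD. Qed.

Lemma tpart1E p v (c : k) : thomog 2 p -> tpart1 (p + tin v + c%:A) = v.
Proof.
move=> hp; rewrite tpart1D tpart1D tpart1_tin (tpart1_homog _ hp) //.
by rewrite (tpart1_homog _ (@thomogZ1 c)) // add0r addr0.
Qed.

Lemma tpart0E p v (c : k) : thomog 2 p -> tpart0 (p + tin v + c%:A) = c.
Proof.
move=> hp; rewrite tpart0D tpart0D tpart0_scalar (tpart0_homog _ hp) //.
by rewrite (tpart0_homog _ (@thomog_tin _ _ v)) // !add0r.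
Qed.

(** [tpart1] and [tpart0] read off the linear and scalar terms, and the quadratic term is what
    remains. Hence an element of J_2 can be compared term by term with its expression through phi
    and h. *)
Lemma tfilt2_inj p v (c : k) p' v' c' : thomog 2 p -> thomog 2 p' ->
  p + tin v + c%:A = p' + tin v' + c'%:A :> tensor_alg X ->
  [/\ p = p', v = v' & c = c'].
Proof.
move=> hp hp' h.
have ev : v = v' by rewrite -(tpart1E v c hp) h tpart1E.
have ec : c = c' by rewrite -(tpart0E v c hp) h tpart0E.
split; [|exact: ev|exact: ec].
move: h; rewrite -ev -ec => h.
by move/(congr1 (fun z => z - c%:A - tin v)): h; rewrite !addrK.
Qed.

Lemma tpair_linearl (p : tensor_alg X) c (x y : tensor_alg (dual X)) :
  tpair (c *: x + y) p = c * tpair x p + tpair y p.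
Proof. by rewrite !tpairE linearP. Qed.

Lemma tpairDl (p : tensor_alg X) (x y : tensor_alg (dual X)) :
  tpair (x + y) p = tpair x p + tpair y p.
Proof. by rewrite !tpairE linearD. Qed.

Lemma tpair2_sym (f g : dual X) (v w : X) :
  tpair (tin f * tin g + tin g * tin f) (tin v * tin w) =
  (f v : k) * (g w : k) + (g v : k) * (f w : k).
Proof. rewrite [LHS]tpairDl; congr (_ + _); exact: tpair2. Qed.

Lemma tpair_linearr (xi : tensor_alg (dual X)) c p q :
  tpair xi (c *: p + q) = c * tpair xi p + tpair xi q.
Proof.
rewrite !tpairE; elim/tensor_indl: xi => [|w|d x y hx hy].
- by rewrite !linear0 mulr0 addr0.
- by rewrite !linext_word linearP.
- rewrite !linearP /= hx hy /GRing.scale /=.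
  by rewrite !mulrDr !mulrA (mulrC d c) addrACA.
Qed.

Lemma tpairr0 (xi : tensor_alg (dual X)) : tpair xi 0 = 0.
Proof.
have := tpair_linearr xi 1 0 0; rewrite scaler0 addr0 mul1r => /esym/eqP.
by rewrite -subr_eq0 addrK => /eqP.
Qed.

End Tensors.

(** For [a] of degree 1 and [b] of degree [n], the terms [a * alpha * b] coming from the two
    supercommutators cancel. With [da] and [db] the values of a derivation, this is the Leibniz rule
    for [d + [alpha, .]]. *)
Lemma scomm_leibniz (R : nzRingType) n (alpha a b da db : R) :
  (da + scomm 1 1 alpha a) * b + (-1) ^+ 1 * (a * (db + scomm 1 n alpha b)) =
  da * b + (-1) ^+ 1 * (a * db) + scomm 1 n.+1 alpha (a * b).
Proof.
rewrite /scomm !mul1n expr1 !mulN1r opprK exprS mulN1r mulNr opprK.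
rewrite mulrDl -!addrA; congr (_ + _).
have -> : a * (db + (alpha * b - (-1) ^+ n * (b * alpha))) =
    a * db + (a * alpha * b - (-1) ^+ n * (a * b * alpha)).
  by rewrite !mulrDr mulrN (mulrA a (_ ^+ n)) commr_sign -!mulrA.
rewrite opprD opprB mulrDl [LHS]addrCA; congr (_ + _).
by rewrite -addrA [X in _ + X]addrC subrK mulrA.
Qed.

(** * Derivations of a quadratic algebra are determined in degree 1 *)

Section QuadraticDerivations.
Variables (k : fieldType) (X : vectType k) (R : tensor_alg X -> Prop).
Local Notation B := (quad_alg R).
Local Notation q := (quad_pi R).

Lemma quad_piD x y : q (x + y) = q x + q y :> B.
Proof. exact: linearD. Qed.

Lemma quad_piM x y : q (x * y) = q x * q y :> B.
Proof. exact: rmorphM. Qed.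

Lemma quad_piZ c x : q (c *: x) = c *: q x :> B.
Proof. exact: linearZ. Qed.

Lemma quad_pi_one : q 1 = 1 :> B.
Proof. exact: rmorph1. Qed.

Lemma cdg_d1 (Psi : cdg_algebra B) : cdg_d Psi 1 = 0.
Proof.
have h1 : gcomp 0 (1 : B) by exact: (gr1 (gcompP B)).
have := cdg_leibniz Psi 1 h1; rewrite expr0 !mul1r mulr1 => /esym/eqP.
by rewrite -subr_eq0 addrK => /eqP.
Qed.

Lemma scomm_linear m n (alpha : B) c a b :
  scomm m n alpha (c *: a + b) = c *: scomm m n alpha a + scomm m n alpha b.
Proof.
rewrite /scomm mulrDr mulrDl mulrDr -scalerAr -scalerAl -scalerAr.
by rewrite scalerBr opprD addrACA.
Qed.

Lemma scomm1r m (alpha : B) : scomm m 0 alpha 1 = 0.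
Proof. by rewrite /scomm muln0 expr0 mul1r mul1r mulr1 subrr. Qed.

(* Both sides are derivations of degree 1, so generators suffice. *)
Lemma cdg_d_twist_ext (Psi Psi' : cdg_algebra B) (alpha : B) :
  (forall v, cdg_d Psi' (q (tin v)) =
     cdg_d Psi (q (tin v)) + scomm 1 1 alpha (q (tin v))) ->
  forall n (b : B), gcomp n b ->
    cdg_d Psi' b = cdg_d Psi b + scomm 1 n alpha b.
Proof.
move=> hgen n _ [x hx ->].
rewrite (tensorE x).
pose P (y : tensor_alg X) :=
  cdg_d Psi' (q y : B) = cdg_d Psi (q y : B) + scomm 1 n alpha (q y : B).
apply: (@linext_closed _ _ _ _ P) => [|c a b ha hb|w /hx hw].
- rewrite /P -(scale0r 1) quad_piZ scale0r !linear0 /scomm.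
  by rewrite mulr0 mul0r mulr0 subr0 addr0.
- rewrite /P quad_piD quad_piZ linearP [X in _ = X + _]linearP scomm_linear.
  rewrite ha hb scalerDr; exact: addrACA.
(* Linearity was used at fixed degree [n]. Only now is [n] replaced by the length of the word, since
   the sign in the supercommutator must vary along the induction. *)
rewrite /P -hw {P hx hw}; case: w => s /=; elim: s => [|i s IH].
  rewrite -tword1 quad_pi_one !cdg_d1 [scomm _ _ _ _]scomm1r.
  by rewrite addr0.
have -> : tword (FMonom (i :: s) : word X) = tin (tbasis i) * tword (FMonom s).
  by rewrite !twordE big_cons.
have hg : gcomp 1 (q (tin (tbasis i)) : B).
  by exists (tin (tbasis i)) => //; apply: thomog_tin.
rewrite quad_piM (cdg_leibniz Psi' _ hg) (cdg_leibniz Psi _ hg).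
rewrite hgen IH; exact: scomm_leibniz.
Qed.

End QuadraticDerivations.

Lemma scaler_add3 (k : pzRingType) (U : lmodType k) (c s t : k) (x y z x' y' : U) :
  c *: (x + y + s *: z) + (x' + y' + t *: z) =
  c *: x + x' + (c *: y + y') + (c * s + t) *: z.
Proof.
by rewrite scalerDl -scalerA [X in X + _ = _]scalerDr scalerDr addrACA
  [X in X + _ = _]addrACA.
Qed.

(** Applied in A to two generators written as elements of [V'] plus multiples of the unit: the
    middle term is the linear correction, the last one the scalar correction. *)
Lemma mulDalg (k : comNzRingType) (R : algType k) (x y : R) (a b : k) :
  (x + a%:A) * (y + b%:A) = x * y + (a *: y + b *: x) + (a * b)%:A.
Proof.
rewrite mulrDl !mulrDr mulr_algl mulr_algr mulr_algl scalerA.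
by rewrite addrA -(addrA (x * y)) (addrC (b *: x)).
Qed.

(** * Change of the complement to k·e *)

Section Complements.
Variables (k : fieldType) (A : algType k) (W : unital_subspace A).
Implicit Types V : {vspace W}.
Local Notation e := (gunit W).

Lemma gunit_neq0 : e != 0.
Proof.
by apply/eqP => e0; have := gunitE W; rewrite e0 linear0 => /esym/eqP; rewrite oner_eq0.
Qed.

(** [W/ke] is modelled on a subspace of [W], so [vsval] is a section of the projection. *)
Lemma quotv_pi_val (u : Wbar W) : Wpi W (vsval u) = u.
Proof.
apply: val_inj; rewrite -[LHS]/(vsval _) quotv_piE.
by apply: daddv_pi_id (subvsP u); rewrite capvC capv_compl.
Qed.

Lemma Wpi_eqP x y : Wpi W x = Wpi W y -> x - y \in <[e]>%VS.
Proof.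
by move=> h; rewrite -(quotv_pi_ker <[e]>%VS) memv_ker linearB /= -/(Wpi W) h subrr.
Qed.

Lemma Wpi_gunit : Wpi W e = 0.
Proof. by apply/eqP; rewrite -memv_ker quotv_pi_ker memv_line. Qed.

Lemma complement_lift V : complement V -> forall x : W,
  exists2 v, v \in V & Wpi W v = Wpi W x.
Proof.
move=> [hD _] x; have : x \in (V + <[e]>)%VS by rewrite hD memvf.
case/memv_addP => v hv [_ /vlineP [c ->] ->]; exists v => //.
by rewrite linearD linearZ /= Wpi_gunit scaler0 addr0.
Qed.

Lemma complement_inj V v w : complement V -> v \in V -> w \in V ->
  Wpi W v = Wpi W w -> v = w.
Proof.
move=> [_ hI] hv hw /Wpi_eqP h; apply/eqP; rewrite -subr_eq0 -memv0 -hI memv_cap.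
by rewrite h rpredB.
Qed.

(** For complements [V] and [V'], the projections onto them along k·e differ by a multiple of [e],
    whose coefficient [coord] extracts. As a composite of linear maps, this is a linear form by
    construction. *)
Definition change_fun V V' : dual (Wbar W) :=
  (linfun (coord [tuple e] ord0 : W -> k^o) \o
    (daddv_pi V <[e]>%VS - daddv_pi V' <[e]>%VS) \o
    linfun (vsval : Wbar W -> W))%VF.

Lemma change_fun_coord V V' u : change_fun V V' u =
  coord [tuple e] ord0
    (daddv_pi V <[e]>%VS (vsval u) - daddv_pi V' <[e]>%VS (vsval u)).
Proof. by rewrite /change_fun !comp_lfunE !lfunE /= opp_lfunE. Qed.

(** [vsval (Wpi W v)] may differ from [v], but has the same class in [W/ke]; projecting along k·e
    keeps the class, and [V] contains only one element of it. *)
Lemma daddv_pi_complement V v : complement V -> v \in V ->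
  daddv_pi V <[e]>%VS (vsval (Wpi W v)) = v.
Proof.
move=> hV vV; have [hD hI] := hV.
apply: (complement_inj hV (memv_pi _ _ _) vV).
have := daddv_pi_add hI (w := vsval (Wpi W v)); rewrite hD memvf => /(_ isT) hw.
rewrite -[RHS]quotv_pi_val -[in RHS]hw linearD.
have /vlineP [c ->] := memv_pi <[e]>%VS V (vsval (Wpi W v)).
by rewrite linearZ /= Wpi_gunit scaler0 addr0.
Qed.

Lemma change_funE V V' v v' : complement V -> complement V' ->
  v \in V -> v' \in V' -> Wpi W v = Wpi W v' ->
  v - v' = change_fun V V' (Wpi W v) *: e.
Proof.
move=> hV hV' vV vV' hvv'.
rewrite change_fun_coord daddv_pi_complement // hvv' daddv_pi_complement //.
have /vlineP [c ->] := Wpi_eqP hvv'.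
have fe : free [tuple e] by rewrite seq1_free gunit_neq0.
rewrite linearZ /= -[X in coord _ _ X]/([tuple e]`_(ord0 : 'I_1)) coord_free //.
by rewrite eqxx mulr1.
Qed.

(** Each class in [W/ke] has representatives in both [V] and [V']. As [e] is nonzero, their
    difference fixes the value of the form on that class. *)
Lemma complement_diff_unique V V' : complement V -> complement V' ->
  unique (complement_diff V V') (dual_gen (change_fun V V')).
Proof.
move=> hV hV'; split.
  exists (change_fun V V') => // v v' vV vV'; exact: change_funE.
move=> _ [a -> ha]; congr dual_gen; apply/lfunP => u.
have [v vV hv] := complement_lift hV (vsval u).
have [v' vV' hv'] := complement_lift hV' (vsval u).
rewrite quotv_pi_val in hv hv'.
have h : Wpi W v = Wpi W v' by rewrite hv hv'.
have := ha v v' vV vV' h; rewrite (change_funE hV hV' vV vV' h) hv.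
move/eqP; rewrite -subr_eq0 -scalerBl scaler_eq0 (negPf gunit_neq0) orbF subr_eq0.
by move/eqP.
Qed.

(** For complements, this is the identification of [V] with [V'] through [W/ke]. *)
Definition shift V V' (v : subvs_of V) : subvs_of V' :=
  vsproj V' (daddv_pi V' <[e]>%VS (vsval v)).

Lemma shiftE V V' (v : subvs_of V) : complement V -> complement V' ->
  Wpi W (vsval (shift V' v)) = Wpi W (vsval v) /\
  vsval v = vsval (shift V' v) + change_fun V V' (Wpi W (vsval v)) *: e.
Proof.
move=> hV hV'; have [hD hI] := hV'.
have hs : Wpi W (vsval (shift V' v)) = Wpi W (vsval v).
  have := daddv_pi_add hI (w := vsval v); rewrite hD memvf => /(_ isT) hw.
  rewrite /shift vsprojK ?memv_pi // -[in RHS]hw linearD.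
  have /vlineP [c ->] := memv_pi <[e]>%VS V' (vsval v).
  by rewrite linearZ /= Wpi_gunit scaler0 addr0.
split=> //.
rewrite -(change_funE hV hV' (subvsP v) (subvsP (shift V' v)) (esym hs)).
by rewrite addrC subrK.
Qed.

Lemma gincl_shift V (v : subvs_of V) c :
  gincl W (vsval v + c *: e) = gincl W (vsval v) + c%:A.
Proof. by rewrite linearD linearZ gunitE. Qed.

Lemma gincl_comb V (x y : subvs_of V) c d :
  gincl W (vsval (c *: x + d *: y)) =
  c *: gincl W (vsval x) + d *: gincl W (vsval y).
Proof. by rewrite [vsval _]linearD [gincl W _]linearD !linearZ. Qed.

Lemma tensor_eval_tin V (v : subvs_of V) : tensor_eval (tin v) = gincl W (vsval v).
Proof. exact: (tlift_tin (gincl W \o vsval)). Qed.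

Lemma tensor_evalD V (x y : tensor_alg (subvs_of V)) :
  tensor_eval (x + y) = tensor_eval x + tensor_eval y.
Proof. exact: linearD. Qed.

Lemma tensor_evalZ V c (x : tensor_alg (subvs_of V)) :
  tensor_eval (c *: x) = c *: tensor_eval x.
Proof. exact: linearZ. Qed.

Lemma tensor_evalM V (x y : tensor_alg (subvs_of V)) :
  tensor_eval (x * y) = tensor_eval x * tensor_eval y.
Proof. exact: rmorphM. Qed.

Lemma tensor_eval_scalar V (c : k) :
  tensor_eval (c%:A : tensor_alg (subvs_of V)) = c%:A.
Proof. by rewrite tensor_evalZ; congr (_ *: _); apply: rmorph1. Qed.

Lemma tproj_tin V (v : subvs_of V) : tproj (tin v) = tin (Wpi W (vsval v)).
Proof. exact: (tlift_tin (@tin _ (Wbar W) \o (Wpi W \o vsval))). Qed.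

Lemma tensor_eval_tin2 V (u v : subvs_of V) :
  tensor_eval (tin u * tin v) = gincl W (vsval u) * gincl W (vsval v).
Proof.
exact: etrans (tensor_evalM _ _) (congr2 *%R (tensor_eval_tin u) (tensor_eval_tin v)).
Qed.

Lemma tensor_eval_low V (p : tensor_alg (subvs_of V)) v (c : k) :
  tensor_eval (p + tin v + c%:A) = tensor_eval p + gincl W (vsval v) + c%:A.
Proof. by rewrite [LHS]tensor_evalD (tensor_evalD p) (tensor_eval_tin v) tensor_eval_scalar. Qed.

Lemma tproj_linear V c (x y : tensor_alg (subvs_of V)) :
  tproj (c *: x + y) = c *: tproj x + tproj y.
Proof. exact: linearP. Qed.

Lemma dual_linear V (beta : dual (Wbar W)) c (x y : subvs_of V) :
  beta (Wpi W (vsval (c *: x + y))) =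
  c * (beta (Wpi W (vsval x)) : k) + (beta (Wpi W (vsval y)) : k) :> k.
Proof. by rewrite !linearP. Qed.

Lemma dual_scale V (beta : dual (Wbar W)) c (x : subvs_of V) :
  beta (Wpi W (vsval (c *: x))) = c * (beta (Wpi W (vsval x)) : k) :> k.
Proof. by rewrite -[_ *: _]addr0 dual_linear !linear0; apply: addr0. Qed.

Lemma tproj0 V : tproj (0 : tensor_alg (subvs_of V)) = 0.
Proof. exact: linear0. Qed.

Lemma tprojM V (x y : tensor_alg (subvs_of V)) : tproj (x * y) = tproj x * tproj y.
Proof. exact: rmorphM. Qed.

Lemma tproj_tin2 V (u v : subvs_of V) :
  tproj (tin u * tin v) = tin (Wpi W (vsval u)) * tin (Wpi W (vsval v)).
Proof. exact: etrans (tprojM _ _) (congr2 *%R (tproj_tin u) (tproj_tin v)). Qed.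

Lemma dual_genM (f g : dual (Wbar W)) :
  dual_gen f * dual_gen g = dual_pi (tin f * tin g) :> dual_alg W.
Proof. exact/esym/quad_piM. Qed.

(** Between two elements of degree 1 the supercommutator is the anticommutator. *)
Lemma dual_gen_anticomm (f g : dual (Wbar W)) (xi : tensor_alg (dual (Wbar W))) :
  dual_pi xi + scomm 1 1 (dual_gen f) (dual_gen g) =
  dual_pi (xi + (tin f * tin g + tin g * tin f)) :> dual_alg W.
Proof.
rewrite [RHS]quad_piD [X in _ = _ + X]quad_piD /scomm mulN1r opprK.
by apply: (congr1 (+%R (dual_pi xi))); apply: congr2; apply: dual_genM.
Qed.

Lemma dual_gen_square (f : dual (Wbar W)) (xi eta : tensor_alg (dual (Wbar W))) :
  dual_pi xi + dual_pi eta + dual_gen f ^+ 2 =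
  dual_pi (xi + eta + tin f * tin f) :> dual_alg W.
Proof.
rewrite [RHS]quad_piD [X in _ = X + _]quad_piD expr2.
exact: (congr1 (+%R (dual_pi xi + dual_pi eta)) (dual_genM f f)).
Qed.

(** This is the injectivity of B^2 -> I^*: the difference annihilates I, hence is a defining
    relation of B. Testing on the I of a single complement suffices because [quadI] can be computed
    from any of them. *)
Lemma dual_pi_ext V xi1 xi2 : complement V -> thomog 2 xi1 -> thomog 2 xi2 ->
  (forall p : tensor_alg (subvs_of V), relI p ->
     tpair xi1 (tproj p) = tpair xi2 (tproj p)) ->
  dual_pi xi1 = dual_pi xi2 :> dual_alg W.
Proof.
move=> hV h1 h2 h; suff hr : quad_rel (annihilator (@quadI _ _ W)) (xi1 - xi2).
  by apply/quot_piE; apply: ideal_gen_in.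
split.
  by rewrite addrC -scaleN1r; apply: thomogD.
move=> _ /(quadI_complement hV) [p hp ->].
by rewrite addrC -scaleN1r tpair_linearl h // mulN1r addNr.
Qed.

(* In degree 2: [u v = (u' + a u) (v' + a v) = u' v' + (a u v' + a v u') + a u a v]
   in [A], for [u'], [v'] the representatives in [V'] of [u], [v]. *)
Lemma shift_quadratic V V' (q : tensor_alg (subvs_of V)) :
  complement V -> complement V' -> thomog 2 q ->
  let a := change_fun V V' in
  exists (p : tensor_alg (subvs_of V')) (l : subvs_of V'),
  [/\ thomog 2 p, tproj p = tproj q,
      forall beta : dual (Wbar W), (beta (Wpi W (vsval l)) : k) =
        tpair (tin a * tin beta + tin beta * tin a) (tproj q)
    & tensor_eval q =
        tensor_eval (p + tin l + (tpair (tin a * tin a) (tproj q))%:A)].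
Proof.
(* All four clauses are linear in [q], [p] and [l] jointly, so witnesses can be combined linearly
   and only products of two vectors need a computation. *)
move=> hV hV' hq a; elim/thomog2_ind: q / hq => [|c x y|u v].
- exists 0, 0; split.
  + exact: thomog0.
  + by rewrite !tproj0.
  + by move=> beta; rewrite tproj0 tpairr0 !linear0.
  + by rewrite tproj0 tpairr0 scale0r linear0 !addr0 /tensor_eval !linear0.
- move=> [p [l [hp pE lE eE]]] [p' [l' [hp' pE' lE' eE']]].
  exists (c *: p + p'), (c *: l + l'); split.
  + exact: thomogD.
  + by rewrite !tproj_linear pE pE'.
  + move=> beta; rewrite [LHS]dual_linear (lE beta) (lE' beta) tproj_linear.
    by rewrite [RHS]tpair_linearr.
  + rewrite tproj_linear tpair_linearr [LHS]tensor_evalD [X in X + _]tensor_evalZ.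
    rewrite eE eE' -tensor_evalZ -tensor_evalD; congr tensor_eval.
    rewrite [tin (_ + _)](linearP (@tin _ _)); exact: scaler_add3.
- have [us uE] := shiftE u hV hV'; have [vs vE] := shiftE v hV hV'.
  exists (tin (shift V' u) * tin (shift V' v)).
  exists ((a (Wpi W (vsval u)) : k) *: shift V' v +
          (a (Wpi W (vsval v)) : k) *: shift V' u).
  split.
  + exact: (@thomogM _ _ 1 1 _ _ (@thomog_tin _ _ _) (@thomog_tin _ _ _)).
  + by rewrite [LHS]tproj_tin2 us vs [RHS]tproj_tin2.
  + move=> beta; rewrite tproj_tin2 [RHS]tpair2_sym [LHS]dual_linear dual_scale us vs.
    congr (_ + _); exact: mulrC.
  + rewrite tproj_tin2 tpair2.
    rewrite tensor_eval_low 2!tensor_eval_tin2.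
    rewrite [in LHS]uE [in LHS]vE 2!gincl_shift gincl_comb.
    exact: mulDalg.
Qed.

(** The relation with leading term [q], rewritten in terms of [V'], is again a relation of A. Its
    leading term [p] has the same image as [q] over [W/ke], and its lower terms must be [phi' p] and
    [h' p]. *)
Lemma relation_change V V' phi h phi' h' :
  complement V -> complement V' ->
  (forall x : tensor_alg (subvs_of V), relJ2 x <->
     exists2 p, relI p & x = p + tin (phi p) + (h p)%:A) ->
  (forall x : tensor_alg (subvs_of V'), relJ2 x <->
     exists2 p, relI p & x = p + tin (phi' p) + (h' p)%:A) ->
  let a := change_fun V V' in
  forall q, relI q -> exists p,
  [/\ relI p, tproj p = tproj q,
      forall beta : dual (Wbar W), (beta (Wpi W (vsval (phi' p))) : k) =
        (beta (Wpi W (vsval (phi q))) : k) +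
        tpair (tin a * tin beta + tin beta * tin a) (tproj q)
    & h' p = h q + (a (Wpi W (vsval (phi q))) : k) + tpair (tin a * tin a) (tproj q)].
Proof.
move=> hV hV' hJ hJ' a q hq.
have [p [l [hp pE lE eE]]] := shift_quadratic hV hV' hq.1; rewrite -/a in lE eE.
(* Replacing [phi q] by its representative in [V'] contributes the shifted vector to the linear term
   and [a(phi q)] to the scalar one; the rest comes from [q]. *)
pose l' := l + shift V' (phi q).
pose c := h q + (a (Wpi W (vsval (phi q))) : k) + tpair (tin a * tin a) (tproj q).
have [sE sE'] := shiftE (phi q) hV hV'; rewrite -/a in sE'.
have hlow : tfilt 1 (tin l' + c%:A).
  by apply: tfiltDl; [apply: tfilt_thomog (@thomog_tin _ _ _)
                     |apply: tfilt_thomog (@thomogZ1 _ _ _)].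
have yJ : relJ2 (p + (tin l' + c%:A)).
  split; last first.
    apply: tfiltDl; first exact: tfilt_thomog hp.
    by move=> w /hlow hw; apply: leq_trans hw _.
  (* The rewritten element has the same value in A as this relation, namely zero. *)
  have [hq0 _] : relJ2 (q + tin (phi q) + (h q)%:A) by apply/hJ; exists q.
  rewrite /relJ addrA -[RHS]hq0 [LHS]tensor_eval_low [RHS]tensor_eval_low eE.
  rewrite tensor_eval_low sE'.
  rewrite gincl_shift /l' /c [vsval _]linearD [gincl W _]linearD !scalerDl.
  by rewrite [RHS](AC (3*2*1) (1*(2*4)*(6*5*3))).
have pI : relI p by split=> //; exists (tin l' + c%:A).
(* [hJ'] expresses the same element through some [p']; comparing degrees forces [p' = p] and
   identifies the lower terms. *)
have [p' p'I] := (hJ' _).1 yJ; rewrite addrA.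
move/(tfilt2_inj hp p'I.1) => [ep el ec]; rewrite -ep in el ec.
exists p; split=> //.
move=> beta; rewrite -el /l' -[l]scale1r dual_linear mul1r sE lE; exact: addrC.
Qed.

End Complements.

(** * The twist relating the two CDG-algebras *)

Theorem proposition2p3 (k : fieldType) (A : algType k) (W : unital_subspace A)
    (HA : weak_qls W) (V V' : {vspace W})
    (HV : complement V) (HV' : complement V')
    (Psi Psi' : cdg_algebra (dual_alg W))
    (HPsi : cdg_of V Psi) (HPsi' : cdg_of V' Psi') :
  exists alpha : dual_alg W,
    [/\ gcomp 1 alpha, unique (complement_diff V V') alpha
      & cdg_twist Psi alpha Psi'].
Proof.
pose a := change_fun V V'; exists (dual_gen a).
split; [|exact: complement_diff_unique|].
  by exists (tin a) => //; apply: thomog_tin.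
have [phi [h [hJ hd [xi [hxi eh] hh]]]] := HPsi.
have [phi' [h' [hJ' hd' [xi' [hxi' eh'] hh']]]] := HPsi'.
have change := relation_change HV HV' hJ hJ'; rewrite -/a in change.
have thomog2 (f g : dual (Wbar W)) : thomog 2 (tin f * tin g).
  exact: (@thomogM _ _ 1 1 _ _ (@thomog_tin _ _ _) (@thomog_tin _ _ _)).
split.
  apply: cdg_d_twist_ext => beta.
  have [eta [heta eeta] veta] := hd beta; have [eta' [heta' eeta'] veta'] := hd' beta.
  rewrite [LHS]eeta' [X in _ = X + _]eeta [RHS]dual_gen_anticomm.
  apply: (dual_pi_ext HV) => //.
    by apply: thomogDl => //; apply: thomogDl.
  move=> q hq; have [p [hp pE phiE _]] := change q hq.
  by rewrite tpairDl (veta _ hq) -pE (veta' _ hp) phiE pE.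
(* [eta] represents [d alpha]: its pairing with the image of [q] is [a(phi q)], the middle term in
   the formula for [h' p]. *)
have [eta [heta eeta] veta] := hd a.
rewrite [LHS]eh' [X in _ = X + _ + _]eh [X in _ = _ + X + _]eeta [RHS]dual_gen_square.
apply: (dual_pi_ext HV) => //; first by do 2?apply: thomogDl.
move=> q hq; have [p [hp pE _ hE]] := change q hq.
rewrite -pE (hh' _ hp) hE pE [RHS]tpairDl (tpairDl (tproj q) xi).
by rewrite (hh _ hq) (veta _ hq).
Qed.
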